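(* For every $n\in 3\mathbb{N}$ with $n\ge 3$, the following $3$-graph $H$ on $n$ vertices has no perfect matching: $V(H)=A\,\dot\cup\,B$ with $|A|=\frac n3+1$ and $|B|=\frac{2n}3-1$, and $E(H)$ consists of all $3$-subsets of $V(H)$ containing at most one vertex from $A$. Moreover each $v\in A$ has degree $$\deg(v)=\binom{\frac{2n}{3}-1}{2}=\frac49\binom n2-\frac{7n}{9}+1,$$ and each $v\in B$ has degree $\deg(v)=\binom{n-1}{2}-\binom{\frac n3+1}{2}$ (which is asymptotically $\frac89\binom n2$ as $n\to\infty$).
   Context: A $3$-graph $H$ is a finite vertex set $V(H)$ together with a set $E(H)$ of $3$-element subsets of $V(H)$ (edges). The degree $\deg(v)$ of a vertex $v$ is the number of edges containing $v$. A perfect matching is a collection of pairwise disjoint edges covering all vertices. *)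

(* Defs.v *)
From mathcomp Require Import all_boot.

Set Implicit Arguments.
Unset Strict Implicit.
Unset Printing Implicit Defensive.

(* A 3-graph whose vertex set is the whole finite type V. *)
Record three_graph (V : finType) := ThreeGraph {
  edges : {set {set V}};
  edges_card : forall e : {set V}, e \in edges -> #|e| = 3
}.

Definition deg (V : finType) (H : three_graph V) (v : V) : nat :=
  #|[set e in edges H | v \in e]|.

Definition perfect_matching (V : finType) (H : three_graph V)
    (M : {set {set V}}) : bool :=
  [&& M \subset edges H, trivIset M & cover M == [set: V]].

Definition space_barrier_edges (V : finType) (A : {set V}) : {set {set V}} :=
  [set e : {set V} | (#|e| == 3) && (#|e :&: A| <= 1)].

Lemma space_barrier_card (V : finType) (A e : {set V}) :
  e \in space_barrier_edges A -> #|e| = 3.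
Proof. by rewrite inE => /andP[/eqP]. Qed.

Definition space_barrier (V : finType) (A : {set V}) : three_graph V :=
  ThreeGraph (@space_barrier_card V A).

Definition bipartition (V : finType) (A B : {set V}) : bool :=
  (A :|: B == [set: V]) && [disjoint A & B].

(* Main.v *)
Require Import Defs.
From mathcomp Require Import all_boot.

(** The edges of a matching meet [A] in at most one vertex each, so a perfect
    matching, which has [n/3] edges, cannot cover the [n/3 + 1] vertices of [A].
    Degrees are counted in the link graph of [v]: it consists of all pairs inside
    [B] when [v] is in [A], and of all pairs of other vertices not contained in
    [A] when [v] is in [B].  For [n = 3m] the latter count is [4m^2 - 5m + 1]
    while [8/9 * 'C(n, 2) = 4m^2 - 4m/3], so they differ by [O(n)]. *)

Lemma card_perfect_matching (V : finType) (H : three_graph V) (M : {set {set V}}) :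
  perfect_matching H M -> #|V| = 3 * #|M|.
Proof.
case/and3P => /subsetP MH /eqP trivM /eqP covM.
rewrite -cardsT -covM -trivM mulnC -sum_nat_const.
by apply: eq_bigr => e /MH; apply: edges_card.
Qed.

Lemma space_barrier_leq_matching (V : finType) (A : {set V}) (M : {set {set V}}) :
  perfect_matching (space_barrier A) M -> #|A| <= #|M|.
Proof.
case/and3P => /subsetP MH trivM /eqP covM.
(* [M] covers everything and its blocks are disjoint, so [#|A|] splits into the sum of [#|e :&: A|]
   over [e] in [M], each term at most 1. *)
have -> : #|A| = \sum_(x in cover M | x \in A) 1.
  by rewrite covM -sum1_card; apply: eq_bigl => x; rewrite inE.
rewrite big_trivIset_cond // -sum1_card; apply: leq_sum => e /MH.
rewrite inE => /andP[_]; apply: leq_trans; rewrite -sum1_card.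
by apply/eq_leq/eq_bigl => x; rewrite inE.
Qed.

Lemma space_barrier_no_perfect_matching (V : finType) (A : {set V}) :
  #|V| < 3 * #|A| -> ~ exists M, perfect_matching (space_barrier A) M.
Proof.
move=> ltVA [M pmM].
move: ltVA; rewrite (card_perfect_matching _ _ _ pmM) ltn_mul2l /= ltnNge.
by rewrite (space_barrier_leq_matching _ _ _ pmM).
Qed.

(** Adding [v] is a bijection from the link of [v] onto the edges through [v], with inverse
    [e :\ v]. *)
Lemma deg_link (V : finType) (H : three_graph V) (v : V) :
  deg H v = #|[set p : {set V} | (v \notin p) && (v |: p \in edges H)]|.
Proof.
rewrite /deg -(@card_in_imset _ _ (fun p => v |: p)); last first.
  move=> p q; rewrite !inE => /andP[vp _] /andP[vq _] /(congr1 (fun e => e :\ v)).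
  by rewrite !setU1K.
congr #|pred_of_set _|; apply/setP => e; rewrite inE.
apply/andP/imsetP => [[eH ve]|[p]].
  exists (e :\ v); last by rewrite setD1K.
  by rewrite !inE eqxx setD1K.
by rewrite inE => /andP[_ pH] ->; rewrite setU11.
Qed.

Lemma deg_space_barrier_in (V : finType) (A : {set V}) (v : V) :
  v \in A -> deg (space_barrier A) v = 'C(#|~: A|, 2).
Proof.
move=> vA; rewrite deg_link -cards_draws; congr #|pred_of_set _|.
apply/setP => p; rewrite !inE; case: (boolP (v \in p)) => /= vp.
  apply/esym/negbTE; rewrite negb_and; apply/orP; left.
  by apply/subsetPn; exists v => //; rewrite !inE vA.
rewrite cardsU1 vp add1n eqSS andbC; congr andb.
(* [v] is already the one vertex of [A] allowed in the edge, so [p] must avoid [A]. *)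
have -> : (v |: p) :&: A = v |: p :&: A.
  by rewrite setIUl; congr setU; apply/setIidPl; rewrite sub1set.
rewrite cardsU1 inE (negbTE vp) /= add1n ltnS leqn0 cards_eq0.
by rewrite setI_eq0 disjoints_subset.
Qed.

Lemma deg_space_barrier_notin (V : finType) (A : {set V}) (v : V) :
  v \notin A -> deg (space_barrier A) v = 'C(#|V|.-1, 2) - 'C(#|A|, 2).
Proof.
move=> vA; rewrite deg_link.
have -> : #|V|.-1 = #|[set~ v]| by rewrite cardsC1.
(* Since [v] lies outside [A], pairs inside [A] are among the pairs avoiding [v], so the difference
   of binomials counts a set difference. *)
rewrite -!cards_draws -cardsDS; last first.
  apply/subsetP => p; rewrite !inE => /andP[pA ->]; rewrite andbT.
  apply/subsetP => x /(subsetP pA) xA; rewrite !inE.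
  by apply: contraNneq vA => <-.
congr #|pred_of_set _|; apply/setP => p; rewrite !inE.
have -> : (p \subset [set~ v]) = (v \notin p).
  by rewrite -disjoints_subset disjoint_sym disjoints1.
case: (boolP (v \in p)) => vp /=; first by rewrite andbF.
rewrite cardsU1 vp add1n eqSS.
have -> : (v |: p) :&: A = p :&: A.
  rewrite setIUl (_ : [set v] :&: A = set0) ?set0U //.
  by apply/eqP; rewrite setI_eq0 disjoints1.
case: eqP => [p2|_]; last by rewrite !andbF.
(* A pair meets [A] in at least two vertices exactly when it is contained in [A]. *)
rewrite !andbT andTb; apply/idP/idP.
  by apply: contraTN => /setIidPl ->; rewrite p2.
apply: contraNT; rewrite -ltnNge => ltpA.
by apply/setIidPl/eqP; rewrite eqEcard subsetIl p2.
Qed.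

Lemma bipartition_setC (V : finType) (A B : {set V}) :
  bipartition A B -> B = ~: A.
Proof.
case/andP => /eqP AUB AB; apply/setP => x; rewrite inE.
have := in_setT x; rewrite -AUB inE.
by case: (boolP (x \in A)) => [/(disjointFr AB) -> | _ /= ->].
Qed.

From mathcomp Require Import all_boot all_order all_algebra.
From mathcomp Require Import all_classical all_reals all_analysis.
From mathcomp Require Import zify lra.
Import Order.TTheory GRing.Theory Num.Theory numFieldNormedType.Exports.
Local Open Scope classical_set_scope.
Local Open Scope ring_scope.

Lemma natr_bin2 (R : realFieldType) (n : nat) :
  ('C(n, 2))%:R = n%:R * (n%:R - 1) / 2 :> R.
Proof.
have e : ('C(n, 2) * 2 = n * n.-1)%N.
  by rewrite (bin_ffact n 2) !ffactnS ffactn0 muln1.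
(* At [n = 0] the predecessor truncates, but both sides vanish. *)
case: n e => [|n] e; first by rewrite bin0n !mul0r.
have := congr1 (fun k => k%:R : R) e; rewrite /= !natrM -[n.+1%:R]natr1; lra.
Qed.

Lemma equiv_deg_space_barrier (R : realType) :
  (fun n : nat => ('C(n - 1, 2))%:R - ('C(n %/ 3 + 1, 2))%:R : R)
    ~_(within [set n : nat | (3 %| n)%N] \oo)
  (fun n : nat => 8 / 9 * ('C(n, 2))%:R : R).
Proof.
apply/eqaddoP => eps eps0; rewrite near_withinE.
near=> n => /dvdnP[m nE].
(* For [n = 3m] the gap is [11m/3 - 1], to be bounded by [eps * (4m^2 - 4m/3)]. From [3m * eps >= 5]
   the latter is at least [20m/3 - 20/9], which suffices once [m >= 1]. *)
have n_large : 5 / eps <= n%:R by near: n; exact: nbhs_infty_ger.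
have m_gt0 : (0 < m)%N.
  case: m nE => // n0; move: n_large; rewrite n0 mul0n.
  by rewrite leNgt divr_gt0.
rewrite ler_pdivrMr // nE natrM in n_large.
have m1 : 1 <= m%:R :> R by rewrite ler1n.
rewrite /= !fctE nE mulnK // !natr_bin2 natrB ?muln_gt0 ?m_gt0 //.
rewrite natrM natrD.
set x := m%:R : R in m1 n_large *.
rewrite ler0_norm; last by nra.
rewrite ger0_norm; last by nra.
nra.
Unshelve. all: by end_near.
Qed.

Theorem mainTheorem2 (R : realType) :
  (forall (n : nat) (V : finType) (A B : {set V}),
     (3 %| n)%N -> (3 <= n)%N ->
     bipartition A B ->
     #|A| = (n %/ 3 + 1)%N -> #|B| = ((2 * n) %/ 3 - 1)%N ->
     [/\ #|V| = n,
         ~ (exists M : {set {set V}}, perfect_matching (space_barrier A) M),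
         forall v : V, v \in A ->
           deg (space_barrier A) v = 'C((2 * n) %/ 3 - 1, 2)%N /\
           ('C((2 * n) %/ 3 - 1, 2))%:R
             = 4 / 9 * ('C(n, 2))%:R - 7 * n%:R / 9 + 1 :> R
       & forall v : V, v \in B ->
           (deg (space_barrier A) v)%:R
             = ('C(n - 1, 2))%:R - ('C(n %/ 3 + 1, 2))%:R :> R]) /\
  (fun n : nat => ('C(n - 1, 2))%:R - ('C(n %/ 3 + 1, 2))%:R : R)
    ~_(within [set n : nat | (3 %| n)%N] \oo)
  (fun n : nat => 8 / 9 * ('C(n, 2))%:R : R).
Proof.
split; last exact: equiv_deg_space_barrier.
move=> n V A B /dvdnP[m ->] n3 AB cA cB.
have BE := bipartition_setC _ _ _ AB.
have cV : #|V| = (m * 3)%N.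
  by have := cardsC A; rewrite -BE cA cB; lia.
have m1 : (1 <= m)%N by lia.
split=> //.
- by apply: space_barrier_no_perfect_matching; rewrite cA cV; lia.
- move=> v vA; rewrite deg_space_barrier_in // -BE cB; split=> //.
  have -> : ((2 * (m * 3)) %/ 3 - 1 = 2 * m - 1)%N by lia.
  rewrite !natr_bin2 natrB ?muln_gt0 // !natrM; lra.
- move=> v; rewrite BE inE => vA.
  rewrite deg_space_barrier_notin // natrB ?cV ?cA ?subn1 //.
  (* The natural subtraction does not truncate: [m + 1 <= 3m - 1] for [m >= 1]. *)
  by apply: leq_bin2l; lia.
Qed.
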